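(* Let $l\ge 0$, $0\le d\le l$ and $s\ge0$ be integers. (1) For $0\le d\le[\frac{l}{2}]$, $$P^l_{d,s}=\begin{cases}P^l_{l-d+1-s}&\text{if } l-2d<s\le l-d,\\ \bigcup_{d+1\le r\le[\frac{l}{2}]+1}P^l_r&\text{if } s=l-2d,\\ \emptyset&\text{if } s<l-2d\text{ or }s>l-d.\end{cases}$$ (2) For $[\frac{l}{2}]\le d\le l$, $$P^l_{d,s}=\begin{cases}P^l_{l-d+1-s}&\text{if } 0<s\le l-d,\\ \bigcup_{l-d+1\le r\le[\frac{l}{2}]+1}P^l_r&\text{if } s=0,\\ \emptyset&\text{if } s>l-d.\end{cases}$$
   Context: $\mathbb{C}[X_0,X_1]_k$ is the space of homogeneous polynomials of degree $k$. For $Q\in\mathbb{C}[\xi_0,\xi_1]$ and $P\in\mathbb{C}[X_0,X_1]$ put $Q\bullet P:=Q(\frac{\partial}{\partial X_0},\frac{\partial}{\partial X_1})(P)$, and $\mathrm{Ann}(P)=\{Q\in\mathbb{C}[\xi_0,\xi_1]\mid Q\bullet P=0\}$. For $P\in\mathbb{C}[X_0,X_1]_l\setminus\{0\}$ and $0\le d\le l$, $$C^d_P:=\mathrm{coker}\big(\mathbb{C}[\xi_0,\xi_1]_d\ni Q\mapsto Q\bullet P\in\mathbb{C}[X_0,X_1]_{l-d}\big).$$ The cactus rank $\mathrm{crank}(P)$ is the minimal length of a $0$-dimensional subscheme $Z\subset\mathbb{P}^1_{\mathbb{C}}$ defined by a homogeneous saturated ideal $I_Z$ contained in $\mathrm{Ann}(P)$.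 Level sets: $P^l_r=\{[P]\in\mathbb{P}(\mathbb{C}[X_0,X_1]_l)\mid\mathrm{crank}(P)=r\}$ for $1\le r\le[\frac{l+2}{2}]$, and $P^l_{d,s}=\{[P]\in\mathbb{P}(\mathbb{C}[X_0,X_1]_l)\mid\dim(C^d_P)=s\}$. $[x]$ denotes the integer part of $x$; a union over an empty index set is empty. *)

(* Defs.v *)
From HB Require Import structures.
From mathcomp Require Import all_boot all_order all_algebra.
From mathcomp Require Import boolp classical_sets reals.
From mathcomp.real_closed Require Import complex.
From mathcomp Require Import ssrcomplements mpoly.

Set Implicit Arguments.
Unset Strict Implicit.
Unset Printing Implicit Defensive.

Import GRing.Theory.

Local Open Scope classical_set_scope.
Local Open Scope ring_scope.

Section QuotientSpace.
Variables (F : fieldType) (V : vectType F).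

(* The vector library has no quotient spaces: V / W is modelled on a complement
   of W, and the two lemmas below state that quotv_proj is onto with kernel W. *)
Definition quotv (W : {vspace V}) : vectType F := subvs_of (W^C)%VS.

Definition quotv_proj (W : {vspace V}) : 'Hom(V, quotv W) :=
  (linfun (vsproj (W^C)) \o daddv_pi (W^C) W)%VF.

Lemma lker_quotv_proj (W : {vspace V}) : lker (quotv_proj W) = W.
Proof.
have dI : (W^C :&: W)%VS = 0%VS by rewrite capvC capv_compl.
have dI' : (W :&: W^C)%VS = 0%VS by rewrite capv_compl.
have split v : daddv_pi (W^C) W v + daddv_pi W (W^C) v = v.
  by apply: daddv_pi_add => //; rewrite addvC addv_complf memvf.
apply/vspaceP => v; rewrite memv_ker comp_lfunE lfunE /=.
have -> : (vsproj (W^C) (daddv_pi (W^C) W v) == 0)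
          = (daddv_pi (W^C) W v == 0).
  apply/eqP/eqP => [|->]; last by rewrite linear0.
  by move/(congr1 vsval); rewrite vsprojK ?memv_pi// => ->; rewrite linear0.
apply/eqP/idP => [e|vW].
  by rewrite -(split v) e add0r memv_pi.
by rewrite -[LHS](addrK v) -{2}(daddv_pi_id dI' vW) split subrr.
Qed.

Lemma limg_quotv_proj (W : {vspace V}) : limg (quotv_proj W) = fullv.
Proof.
apply/vspaceP => u; rewrite memvf.
have dI : (W^C :&: W)%VS = 0%VS by rewrite capvC capv_compl.
suff -> : u = quotv_proj W (vsval u) by apply: memv_img; rewrite memvf.
by rewrite comp_lfunE lfunE /= (daddv_pi_id dI (subvsP u)) vsvalK.
Qed.

(* A point of P(V) is a line through the origin of V. *)
Definition projective : Type := {L : {vspace V} | \dim L == 1%N}.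

Lemma dim_line (v : V) : v != 0 -> \dim <[v]>%VS == 1%N.
Proof. by move=> nz; rewrite dim_vline nz. Qed.

Definition proj_pt (v : V) (nz : v != 0) : projective :=
  exist _ <[v]>%VS (dim_line nz).

End QuotientSpace.

Definition coker (F : fieldType) (U V : vectType F) (f : 'Hom(U, V)) :
  vectType F := quotv (limg f).

Section Apolarity.
Variable F : fieldType.

Definition apolar (Q P : {mpoly F[2]}) : {mpoly F[2]} :=
  \sum_(m <- msupp Q) Q@_m *: P^`M[m].

Lemma apolarwE k Q P : (msize Q <= k)%N ->
  apolar Q P = \sum_(m : 'X_{1..2 < k}) Q@_m *: P^`M[m].
Proof.
move=> le; pose I : subFinType _ := 'X_{1..2 < k}.
rewrite /apolar (big_mksub I) /=; first last.
- by move=> m /msize_mdeg_lt /leq_trans /(_ le) ->.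
- exact: msupp_uniq.
by rewrite big_rmcond //= => m /memN_msupp_eq0 ->; rewrite scale0r.
Qed.

Lemma apolar_linear P : linear (apolar^~ P).
Proof.
move=> c Q1 Q2; pose k := maxn (msize (c *: Q1 + Q2)) (maxn (msize Q1) (msize Q2)).
rewrite !(@apolarwE k) ?leq_max ?leqnn ?orbT // scaler_sumr -big_split /=.
by apply: eq_bigr => m _; rewrite mcoeffD mcoeffZ scalerDl scalerA.
Qed.

Lemma apolar_homog d l (Q P : {mpoly F[2]}) :
  Q \is d.-homog -> P \is l.-homog -> apolar Q P \is (l - d).-homog.
Proof.
move=> /dhomogP hQ /dhomogP hP; rewrite /apolar big_seq_cond.
apply: rpred_sum => m /andP[/hQ <- _]; apply: rpredZ.
apply/dhomogP => m'; rewrite mcoeff_msupp mcoeff_mderivm => nz.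
have /hP <- : (m + m')%MM \in msupp P.
  by rewrite mcoeff_msupp; apply: contraNneq nz => ->; rewrite mul0rn.
by rewrite mfD addKn.
Qed.

Definition Ann (P : {mpoly F[2]}) : {pred {mpoly F[2]}} :=
  [pred Q | apolar Q P == 0].

Section Catalecticant.
Variables (l d : nat) (P : dhomog 2 F l).

Definition apolar_map (Q : dhomog 2 F d) : dhomog 2 F (l - d) :=
  DHomog (apolar_homog (dhomog_is_dhomog Q) (dhomog_is_dhomog P)).

Lemma apolar_map_linear : linear apolar_map.
Proof. by move=> c Q1 Q2; apply: val_inj; apply: apolar_linear. Qed.

HB.instance Definition _ :=
  GRing.isLinear.Build F (dhomog 2 F d) (dhomog 2 F (l - d)) _ apolar_map
    apolar_map_linear.

Definition apolar_coker : vectType F := coker (linfun apolar_map).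

End Catalecticant.

Definition homogeneous_ideal (I : {pred {mpoly F[2]}}) : Prop :=
  forall f d, f \in I -> pihomog mdeg d f \in I.

(* (I : m^oo) = I for the irrelevant ideal m; m^N is generated by the forms
   of degree N. *)
Definition saturated_ideal (I : {pred {mpoly F[2]}}) : Prop :=
  forall f N, (forall g, g \is N.-homog -> g * f \in I) -> f \in I.

Definition graded_piece (I : {pred {mpoly F[2]}}) t
  (W : {vspace dhomog 2 F t}) : Prop :=
  forall q : dhomog 2 F t, (q \in W) = (val q \in I).

(* The subscheme of the projective line cut out by I is 0-dimensional of length
   r: its Hilbert polynomial t |-> dim (S/I)_t, t >> 0, is the constant r. *)
Definition has_length (I : {pred {mpoly F[2]}}) (r : nat) : Prop :=
  exists t0, forall t, (t0 <= t)%N ->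
    exists2 W : {vspace dhomog 2 F t},
      graded_piece I W & \dim {: quotv W} = r.

(* idealr_closed asks for proper ideals, that is, for nonempty subschemes. *)
Definition apolar_scheme (P : {mpoly F[2]}) (r : nat) : Prop :=
  exists I : {pred {mpoly F[2]}},
    [/\ idealr_closed I, homogeneous_ideal I, saturated_ideal I,
        has_length I r & {subset I <= Ann P}].

(* The default 0 is only there to make crank total: it is not the length of a
   nonempty subscheme, and it is not reached when P is homogeneous and nonzero. *)
Definition crank (P : {mpoly F[2]}) : nat :=
  xget 0%N [set r | apolar_scheme P r /\
                    forall r', apolar_scheme P r' -> (r <= r')%N].

Definition crank_level (l r : nat) : set (projective (dhomog 2 F l)) :=
  [set p | exists (P : dhomog 2 F l) (nz : P != 0),
             p = proj_pt nz /\ crank P = r].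

Definition coker_level (l d s : nat) : set (projective (dhomog 2 F l)) :=
  [set p | exists (P : dhomog 2 F l) (nz : P != 0),
             p = proj_pt nz /\ \dim {: apolar_coker d P} = s].

End Apolarity.

Arguments crank_level : clear implicits.
Arguments coker_level : clear implicits.

(* Main.v *)
(* Let [I_t] be the graded pieces of an ideal [I] of [S = F[x, y]], and suppose
   that a form [f] of degree [t] with [x f] and [y f] in [I] is itself in [I].
   Comparing [x I_{t+1} + y I_{t+1}] with [I_{t+2}] gives
   [dim I_{t+2} + dim I_t >= 2 dim I_{t+1}]: the Hilbert function of [S/I] is
   concave at [t+1].

   In characteristic 0 this applies to [Ann P] in every degree [t < l]. The
   Hilbert function of [S/Ann P] at [d] is the rank of [Q |-> Q . P], hence at
   most [min(d+1, l-d+1)], and it is positive on [0..l]; concavity then forces it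
   to be [min(d+1, r, l-d+1)], with [r] the least degree of a nonzero form of
   [Ann P]. The number [r] is the cactus rank: the principal ideal of such a form
   is saturated of length [r], and for a saturated ideal of length [r'] the
   Hilbert function is concave everywhere and eventually [r'], so it is at most
   [r'] in degree [r'] and the ideal contains a nonzero form of degree [r']. *)
From HB Require Import structures.
Require Import Defs.
From mathcomp Require Import all_boot all_order all_algebra.
From mathcomp Require Import boolp classical_sets reals.
From mathcomp.real_closed Require Import complex.
From mathcomp Require Import mpoly zify.

Local Open Scope classical_set_scope.

(** * Concave sequences of natural numbers *)

(** Increments of a concave sequence do not increase. Increments may be negative, so they are
    compared by sums rather than truncated differences. *)
Lemma concave_slope (h : nat -> nat) (l : nat) :
  (forall t, t.+2 <= l -> h t.+2 + h t <= 2 * h t.+1) ->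
  forall s u, s <= u -> u < l -> h u.+1 + h s <= h u + h s.+1.
Proof.
move=> hh s u; elim: u => [|u ih] su ul.
  by have -> : s = 0; [lia|rewrite addnC].
have [->|ne] := eqVneq s u.+1; first by rewrite addnC.
have := ih ltac:(lia) ltac:(lia).
have := hh u ltac:(lia).
by lia.
Qed.

(** Take [r] least with [h r <= r]. Below [r] the bound [t.+1] is attained, so [h r.-1 = r] and [h]
    cannot increase from [r.-1] on. Once it leaves the plateau [r] it falls strictly at each step,
    and reaching [h l > 0] forces the other bound [(l - t).+1] to be attained. *)
Lemma concave_profile (h : nat -> nat) (l : nat) :
  (forall t, t.+2 <= l -> h t.+2 + h t <= 2 * h t.+1) ->
  0 < h 0 -> 0 < h l ->
  (forall t, h t <= t.+1) -> (forall t, h t <= (l - t).+1) ->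
  exists r, [/\ 0 < r <= l./2.+1, forall t, t < r -> h t = t.+1, h r <= r &
                forall t, t <= l -> h t = minn t.+1 (minn r (l - t).+1)].
Proof.
move=> /concave_slope slope h0 hl hup hdown.
have ex : exists r, h r <= r.
  (* The bounds [t.+1] and [(l - t).+1] cross near this degree. *)
  by exists l./2.+1; have := hdown l./2.+1; lia.
have [r hr rmin] := ex_minnP ex.
have eqr t : t < r -> h t = t.+1.
  by move=> tr; have := hup t; case: (leqP (h t) t) => [/rmin|]; lia.
have r0 : 0 < r by case: (r) hr h0 => [|//]; lia.
have er : h r.-1 = r by rewrite eqr; lia.
have rl : r <= l./2.+1 by have := hdown r.-1; lia.
exists r; split=> //; first by rewrite r0.
have noninc t : r.-1 <= t -> t < l -> h t.+1 <= h t.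
  by move=> rt tl; have := slope _ _ rt tl; rewrite er prednK //; lia.
have tail t : r.-1 <= t -> t <= l ->
    h t = r \/ (h t < r /\ forall u, t <= u -> u < l -> h u.+1 < h u).
  elim: t => [|t ih] rt tl; first by left; rewrite -er; congr h; lia.
  have [e|ne] := eqVneq r.-1 t.+1; first by left; rewrite -e.
  have rt' : r.-1 <= t by lia.
  have le := noninc t rt' tl.
  have [ht|[ht hu]] := ih rt' ltac:(lia); last first.
    by right; split=> [|u tu]; [lia | apply: hu; lia].
  have [e|{}ne] := eqVneq (h t.+1) r; first by left.
  right; split=> [|u tu ul]; first by lia.
  (* The first drop, from [t] to [t.+1], bounds every later increment. *)
  by have := slope t u ltac:(lia) ul; lia.
move=> t tl; have [tr|rt] := ltnP t r.
  by have := hdown t; rewrite eqr //; lia.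
have [e|[ht hu]] := tail t ltac:(lia) tl; first by have := hdown t; lia.
have fall u : t <= u -> u <= l -> h u + (u - t) <= h t.
  elim: u => [|u ih] tu ul; first by have -> : t = 0; lia.
  have [<-|ne] := eqVneq t u.+1; first by lia.
  by have := ih ltac:(lia) ltac:(lia); have := hu u ltac:(lia) ul; lia.
by have := fall l tl (leqnn l); have := hdown t; lia.
Qed.

Lemma ord2P (i : 'I_2) : i = ord0 \/ i = ord_max.
Proof. by case: i => -[|[|//]] ?; [left|right]; apply/val_inj. Qed.

(** * Binary forms: homogeneous components, divisibility, multiplication maps *)

Section BinaryForms.
Local Set Implicit Arguments.
Local Unset Strict Implicit.
Local Open Scope ring_scope.
Import GRing.Theory.
Variable F : fieldType.
Implicit Types (f g P Q : {mpoly F[2]}).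

Lemma pihomogM r t g f : g \is r.-homog ->
  pihomog mdeg (r + t) (g * f) = g * pihomog mdeg t f.
Proof.
move=> hg; elim/mpolyind: f => [|c m f _ _ ih].
  by rewrite !(mulr0, pihomog0).
rewrite mulrDr -scalerAr !linearP /= {}ih mulrDr -scalerAr.
congr (c *: _ + _); rewrite pihomogX.
have hm : g * 'X_[m] \is (r + mdeg m).-homog by rewrite dhomogM // dhomogX.
case: eqP => [<-|/eqP ne]; first exact: pihomog_dE.
by rewrite (pihomog_ne0 _ hm) ?mulr0 // eqn_add2l.
Qed.

Lemma pihomogM_lt r t g f : g \is r.-homog -> (t < r)%N ->
  pihomog mdeg t (g * f) = 0.
Proof.
move=> hg lt; elim/mpolyind: f => [|c m f _ _ ih].
  by rewrite mulr0 pihomog0.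
rewrite mulrDr -scalerAr !linearP /= {}ih addr0.
have hm : g * 'X_[m] \is (r + mdeg m).-homog by rewrite dhomogM // dhomogX.
by rewrite (pihomog_ne0 _ hm) ?scaler0 //; lia.
Qed.

(** Multiplying by a power of ['X_j] leaves the exponent of ['X_i] unchanged, so every monomial of
    [g] already has that exponent at least [N]; the quotient lowers it by [N]. *)
Lemma mulXn_dvd (i j : 'I_2) N f g : i != j ->
  'X_i ^+ N * f = 'X_j ^+ N * g -> exists h, g = 'X_i ^+ N * h.
Proof.
move=> nij; rewrite !mpolyXn => e.
exists (\sum_(m <- msupp g) g@_m *: 'X_[m - U_(i) *+ N]).
rewrite [LHS]mpolyE mulr_sumr big_seq [RHS]big_seq; apply: eq_bigr => m mg.
rewrite -scalerAr -mpolyXD addmC submK //.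
have : (U_(j) *+ N + m)%MM \in msupp ('X_[U_(i) *+ N] * f).
  by rewrite e mcoeff_msupp -commr_mpolyX mcoeffMX -mcoeff_msupp.
rewrite -commr_mpolyX (perm_mem (msuppMX _ _)) => /mapP[m' _ /mnmP em].
apply/mnm_lepP => k; have := em k; rewrite !mnmDE !mulmnE !mnm1E.
by case: (eqVneq i k) => [<-|//]; rewrite eq_sym (negbTE nij); lia.
Qed.

Section Mulh.
Variables (r t : nat) (g : dhomog 2 F r).

Definition mulh (f : dhomog 2 F t) : dhomog 2 F (r + t) :=
  DHomog (dhomogM (dhomog_is_dhomog g) (dhomog_is_dhomog f)).

Lemma mulh_linear : linear mulh.
Proof. by move=> c f1 f2; apply: val_inj; rewrite /= mulrDr scalerAr. Qed.

HB.instance Definition _ :=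
  GRing.isLinear.Build F (dhomog 2 F t) (dhomog 2 F (r + t)) _ mulh mulh_linear.

Lemma lker_mulh : g != 0 -> lker (linfun mulh) == 0%VS.
Proof.
move=> nz; apply/lker0P => f1 f2; rewrite !lfunE => /(congr1 val) /= e.
by apply/val_inj/mulfI/e; apply: contraNneq nz => e0; apply/eqP/val_inj.
Qed.

End Mulh.

Lemma dim_binary_forms t : \dim {: dhomog 2 F t} = t.+1.
Proof. by rewrite dimvf /dim /= addn1 binSn. Qed.

Lemma dim_leq_binary_forms t (W : {vspace dhomog 2 F t}) : (\dim W <= t.+1)%N.
Proof. by rewrite -(dim_binary_forms t) dimvS ?subvf. Qed.

Lemma codim_binary_forms t (W : {vspace dhomog 2 F t}) :
  \dim {: quotv W} = (t.+1 - \dim W)%N.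
Proof. by rewrite dimvf -[LHS]/(\dim (W^C)) dimv_compl dim_binary_forms. Qed.

Definition linform (i : 'I_2) : dhomog 2 F 1 :=
  DHomog (etrans (dhomogX _ _ _ _) (introT eqP (mdeg1 i))).


(** * Concavity of the Hilbert function *)

Section GradedPieces.
Variables (I : {pred {mpoly F[2]}}) (W : forall t, {vspace dhomog 2 F t}).
Hypothesis WI : forall t, graded_piece I (W t).
Hypothesis mulXI : forall (i : 'I_2) f, f \in I -> 'X_i * f \in I.

Lemma mulX_inter (i j : 'I_2) t (f g : dhomog 2 F (1 + t)) : i != j ->
  mulh (linform i) f = mulh (linform j) g ->
  exists2 h, f = mulh (linform j) h & g = mulh (linform i) h.
Proof.
move=> nij /(congr1 val) /= e.
have [h eg] : exists h, val g = 'X_i * h.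
  have := @mulXn_dvd i j 1 (val f) (val g) nij.
  by rewrite !expr1; apply.
have ef : val f = 'X_j * h.
  apply: (@mulfI _ 'X_i); first by rewrite -msupp_eq0 msuppX.
  by rewrite e eg mulrCA.
have hX k := dhomog_is_dhomog (linform k).
(* The quotient [h] is not known to be homogeneous; its component of degree [t] serves equally well,
   since taking components commutes with multiplication by a variable. *)
exists (DHomog (pihomogP mdeg t h)); apply: val_inj => /=.
  by rewrite -(pihomogM _ _ (hX j)) -ef pihomog_dE ?dhomog_is_dhomog.
by rewrite -(pihomogM _ _ (hX i)) -eg pihomog_dE ?dhomog_is_dhomog.
Qed.

(* [x W_{t+1} + y W_{t+1}] lies in [W_{t+2}], and
   [x W_{t+1} :&: y W_{t+1} = xy W_t] because [I] is saturated in degree [t]. *)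
Lemma graded_piece_convex t :
  (forall f : dhomog 2 F t, (forall i, 'X_i * val f \in I) -> val f \in I) ->
  (2 * \dim (W (1 + t)) <= \dim (W (1 + (1 + t))) + \dim (W t))%N.
Proof.
move=> sat; pose m (i : 'I_2) t' : 'Hom(dhomog 2 F t', _) :=
  linfun (mulh (linform i)).
have linform_neq0 i : linform i != 0.
  by apply/eqP => /(congr1 val) /= /eqP; rewrite -msupp_eq0 msuppX.
have dim_m i t' U : \dim (m i t' @: U) = \dim U.
  by apply: limg_dim_eq; rewrite (eqP (lker_mulh _ (linform_neq0 i))) capv0.
pose i0 : 'I_2 := ord0; pose i1 : 'I_2 := ord_max.
rewrite mul2n -addnn -{1}(dim_m i0 _ (W (1 + t))) -(dim_m i1 _ (W (1 + t))) -dimv_sum_cap.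
apply: leq_add.
  apply/dimvS/subvP => f /memv_addP[f0 h0 [f1 h1 ->]]; apply: rpredD.
    case/memv_imgP: h0 => g; rewrite WI => gI ->.
    by rewrite lfunE WI; apply: mulXI.
  case/memv_imgP: h1 => g; rewrite WI => gI ->.
  by rewrite lfunE WI; apply: mulXI.
have <- : \dim (m i0 _ @: (m i1 _ @: W t)) = \dim (W t) by rewrite !dim_m.
apply/dimvS/subvP => f.
rewrite memv_cap => /andP[/memv_imgP[f0 f0W ->] /memv_imgP[f1 f1W]].
rewrite !lfunE => e.
have [//|h e0 e1] := @mulX_inter i0 i1 t f0 f1 _ e.
rewrite e0; apply/memv_imgP; exists (mulh (linform i1) h); last by rewrite lfunE.
apply/memv_imgP; exists h; last by rewrite lfunE.
move: f0W f1W; rewrite !WI e0 e1 => hI1 hI0; apply: sat => i.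
by case: (ord2P i) => ->.
Qed.

(** The dimension [t.+1] of the space of forms is affine in [t], so passing to codimensions reverses
    the inequality. *)
Lemma graded_piece_concave t :
  (forall f : dhomog 2 F t, (forall i, 'X_i * val f \in I) -> val f \in I) ->
  (\dim {: quotv (W t.+2)} + \dim {: quotv (W t)}
     <= 2 * \dim {: quotv (W t.+1)})%N.
Proof.
move=> /graded_piece_convex cvx; rewrite !codim_binary_forms.
have le k := dim_leq_binary_forms (W k).
by move: cvx (le t) (le t.+1) (le t.+2); rewrite !add1n; lia.
Qed.

End GradedPieces.

(** * Saturated ideals of given length *)

Section SaturatedIdeals.
Variable I : {pred {mpoly F[2]}}.
Hypotheses (idI : idealr_closed I) (satI : saturated_ideal I).

Lemma ideal_mul f g : g \in I -> f * g \in I.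
Proof.
by case: idI => I0 _ IM gI; have := IM f g 0 gI I0; rewrite addr0.
Qed.

Lemma saturated_linform f : (forall i : 'I_2, 'X_i * f \in I) -> f \in I.
Proof.
move=> hX; apply: (satI (N := 1)) => g /dhomogP hg.
case: idI => I0 _ IM; rewrite [g]mpolyE mulr_suml big_seq.
apply: (big_ind (fun f => f \in I)) => // [u v uI vI|m /hg /= /eqP].
  by have := IM 1 u v uI vI; rewrite mul1r.
rewrite mdeg_eq1 => /existsP[i /eqP ->].
by rewrite -mul_mpolyC -mulrA; apply: ideal_mul.
Qed.

(** [has_length] provides graded pieces in large degrees only. By saturation, the piece of degree
    [t] consists of the forms that both variables send into the piece of degree [1 + t], so one can
    descend. *)
Lemma saturated_graded_pieces t0 :
  (forall t, (t0 <= t)%N -> exists W : {vspace dhomog 2 F t}, graded_piece I W) ->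
  forall t, exists W : {vspace dhomog 2 F t}, graded_piece I W.
Proof.
elim: t0 => [|t0 ih] h t; first exact: h.
apply: ih => {}t le_t; have [W WI] := h (1 + t)%N le_t.
pose m i : 'Hom(dhomog 2 F t, _) := linfun (mulh (linform i)).
exists (m ord0 @^-1: W :&: m ord_max @^-1: W)%VS => f.
rewrite memv_cap -!memv_preim !WI !lfunE /=.
apply/andP/idP => [[h0 h1]|fI]; last by split; apply: ideal_mul.
by apply: saturated_linform => i; case: (ord2P i) => ->.
Qed.

Lemma saturated_form_of_length r : has_length I r ->
  exists2 q : dhomog 2 F r, q != 0 & val q \in I.
Proof.
case=> t0 len.
have exW : forall t, exists W : {vspace dhomog 2 F t}, graded_piece I W.
  by apply: (saturated_graded_pieces (t0 := t0)) => t /len[W]; exists W.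
pose W t := sval (cid (exW t)).
have WI t : graded_piece I (W t) by exact: svalP (cid (exW t)).
pose h t := \dim {: quotv (W t)}.
have len_h t : (t0 <= t)%N -> h t = r.
  case/len=> W' W'I <-; congr (\dim {: quotv _}).
  by apply/vspaceP => q; rewrite WI W'I.
have slope s u : (s <= u -> h u.+1 + h s <= h u + h s.+1)%N.
  move=> su; apply: (@concave_slope _ u.+1) => // t _.
  apply: (graded_piece_concave WI) => [i f|f hX]; first exact: ideal_mul.
  exact: saturated_linform.
(* The increment at [r + t0] is zero, both degrees being past [t0]; by concavity no earlier
   increment is negative. *)
have noninc : (h r <= h (r + t0))%N.
  have mono k : (k <= t0)%N -> (h r <= h (r + k))%N.
    elim: k => [|k ih] kt; first by rewrite addn0.
    have := slope (r + k)%N (r + t0)%N.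
    rewrite (len_h (r + t0)%N) ?leq_addl // len_h ?addnS; lia.
  exact: mono.
have: (0 < \dim (W r))%N.
  move: noninc; rewrite (len_h (r + t0)%N) ?leq_addl // /h codim_binary_forms.
  by have := dim_leq_binary_forms (W r); lia.
rewrite lt0n dimv_eq0 -vpick0 => ne; exists (vpick (W r)) => //.
by rewrite -WI memv_pick.
Qed.

End SaturatedIdeals.

(** * The ideal generated by one form *)

Section PrincipalIdeal.
Variables (r : nat) (g : dhomog 2 F r).
Hypotheses (r_gt0 : (0 < r)%N) (g_neq0 : g != 0).

Definition principal : {pred {mpoly F[2]}} :=
  [pred f | `[< exists h, f = val g * h >]].

Let gh := dhomog_is_dhomog g.

Let vg_neq0 : val g != 0.
Proof. by apply: contraNneq g_neq0 => e; apply/eqP/val_inj. Qed.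

Lemma principalP f : reflect (exists h, f = val g * h) (f \in principal).
Proof. exact: asboolP. Qed.

Lemma principal_idealr : idealr_closed principal.
Proof.
split=> [||a _ _ /principalP[u ->] /principalP[v ->]].
- by apply/principalP; exists 0; rewrite mulr0.
(* Properness: as [r > 0], multiples of [g] have no component of degree 0, unlike 1. *)
- apply/principalP => -[h /(congr1 (pihomog mdeg 0))].
  rewrite (pihomogM_lt _ gh) // pihomog_dE ?dhomog1 //.
  by move/eqP; rewrite oner_eq0.
- by apply/principalP; exists (a * u + v); rewrite mulrDr mulrCA.
Qed.

Lemma principal_homogeneous : homogeneous_ideal principal.
Proof.
move=> _ t /principalP[h ->]; apply/principalP.
have [lt|le] := ltnP t r; first by exists 0; rewrite (pihomogM_lt _ gh) ?mulr0.
by exists (pihomog mdeg (t - r) h); rewrite -{1}(subnKC le) (pihomogM _ _ gh).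
Qed.

(* If [x^N f = g a] and [y^N f = g b], then [y^N a = x^N b], so [x^N] divides
   [a] and [g] divides [f]. *)
Lemma principal_saturated : saturated_ideal principal.
Proof.
move=> f N hN; pose i0 : 'I_2 := ord0; pose i1 : 'I_2 := ord_max.
have hX (i : 'I_2) : 'X_i ^+ N \is [in F[2], N.-homog].
  by rewrite -[X in X.-homog]mul1n dhomogMn // dhomogX /= mdeg1.
have /principalP[a ea] := hN _ (hX i0).
have /principalP[b eb] := hN _ (hX i1).
have [||h eh] := @mulXn_dvd i0 i1 N b a => //.
  by apply: (mulfI vg_neq0); rewrite mulrCA -eb mulrCA ea mulrCA.
apply/principalP; exists h; apply: (@mulfI _ ('X_i0 ^+ N)).
  by rewrite mpolyXn -msupp_eq0 msuppX.
by rewrite ea eh mulrCA.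
Qed.

(** Multiplication by [g] is injective, so in degree [r + k] the ideal has dimension [k.+1], hence
    codimension [r]. *)
Lemma principal_length : has_length principal r.
Proof.
exists r => t /subnKC <-; set k := (t - r)%N.
exists (limg (linfun (mulh g))) => [q|].
  apply/memv_imgP/principalP => [[h _ ->]|[h eh]].
    by exists (val h); rewrite lfunE.
  exists (DHomog (pihomogP mdeg k h)); first exact: memvf.
  apply: val_inj; rewrite lfunE /= -(pihomogM _ _ gh) -eh pihomog_dE //.
  exact: dhomog_is_dhomog.
rewrite codim_binary_forms limg_dim_eq; last first.
  by rewrite (eqP (lker_mulh _ g_neq0)) capv0.
by rewrite !dim_binary_forms subSS addnK.
Qed.

End PrincipalIdeal.

(** * The apolar action and its annihilator *)

Section Apolar.

Lemma apolarD P Q1 Q2 : apolar (Q1 + Q2) P = apolar Q1 P + apolar Q2 P.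
Proof. by have := apolar_linear P 1 Q1 Q2; rewrite !scale1r. Qed.

Lemma apolar0 P : apolar 0 P = 0.
Proof. by rewrite /apolar msupp0 big_nil. Qed.

Lemma apolarZ P c Q : apolar (c *: Q) P = c *: apolar Q P.
Proof. by have := apolar_linear P c Q 0; rewrite apolar0 !addr0. Qed.

Lemma apolarr0 Q : apolar Q 0 = 0.
Proof. by rewrite /apolar big1 // => m _; rewrite linear0 scaler0. Qed.

Lemma apolarX m P : apolar 'X_[m] P = P^`M[m].
Proof. by rewrite /apolar msuppX big_seq1 mcoeffX eqxx scale1r. Qed.

Lemma apolarM Q1 Q2 P : apolar (Q1 * Q2) P = apolar Q1 (apolar Q2 P).
Proof.
elim/mpolyind: Q1 => [|c m Q1 _ _ ih]; first by rewrite mul0r !apolar0.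
rewrite mulrDl -scalerAl !apolarD !apolarZ {}ih; congr (_ *: _ + _).
elim/mpolyind: Q2 => [|d m' Q2 _ _ ih].
  by rewrite mulr0 !(apolar0, apolarr0).
rewrite mulrDr -scalerAr !apolarD !apolarZ {}ih !apolarX linearP /=.
by rewrite -mpolyXD apolarX addmC mderivmDm.
Qed.

Lemma Ann_ideal P Q1 Q2 : Q2 \in Ann P -> Q1 * Q2 \in Ann P.
Proof. by rewrite !inE apolarM => /eqP ->; rewrite apolarr0. Qed.

Hypothesis charF0 : [pchar F] =i pred0.

(** A monomial of positive degree has some exponent [m i > 0]; differentiating along [i] multiplies
    its coefficient by [m i], which is nonzero in characteristic 0. *)
Lemma mderiv_eq0 d f : f \is d.+1.-homog ->
  (forall i : 'I_2, f^`M(i) = 0) -> f = 0.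
Proof.
move=> hf df; apply/mpolyP => m; rewrite mcoeff0.
have [e|/dhomog_nemf_coeff] := eqVneq (mdeg m) d.+1; last exact.
have [i mi] : exists i, (0 < m i)%N.
  apply/existsP; move/eqP: e; apply: contraTT; rewrite negb_exists.
  move/forallP => m0; rewrite mdegE big1 // => i _.
  by have := m0 i; rewrite lt0n negbK => /eqP.
have := mcoeff_deriv i (m - U_(i))%MM f; rewrite df mcoeff0 submK.
  move/esym/eqP; rewrite -mulr_natr mulf_eq0 => /orP[/eqP //|].
  by move/pcharf0P: charF0 => ->.
apply/mnm_lepP => k; rewrite mnm1E.
by case: eqVneq => [<-|].
Qed.

(** Both partial derivatives of [apolar Q P] vanish, and it has degree [l - t > 0], so it is
    zero. *)
Lemma Ann_mulX l t (P : dhomog 2 F l) (Q : dhomog 2 F t) : (t < l)%N ->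
  (forall i : 'I_2, 'X_i * val Q \in Ann (val P)) -> val Q \in Ann (val P).
Proof.
move=> tl hX; rewrite inE; apply/eqP/(@mderiv_eq0 (l - t).-1).
  rewrite prednK ?subn_gt0 //.
  exact: apolar_homog (dhomog_is_dhomog Q) (dhomog_is_dhomog P).
by move=> i; have := hX i; rewrite inE apolarM apolarX mderivmU1m => /eqP.
Qed.

(** * Catalecticant ranks and the cactus rank *)

Section Catalecticant.
Variables (l : nat) (P : dhomog 2 F l).
Hypothesis P_neq0 : P != 0.

Let W t := lker (linfun (apolar_map (d := t) P)).
Let rk t := \dim {: quotv (W t)}.

Lemma graded_piece_Ann t : graded_piece (Ann (val P)) (W t).
Proof.
move=> Q; rewrite memv_ker lfunE inE.
by apply/eqP/eqP => [/(congr1 val) //|e]; apply: val_inj.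
Qed.

Lemma codim_Ann t : rk t = \dim (limg (linfun (apolar_map (d := t) P))).
Proof.
rewrite /rk codim_binary_forms -dim_binary_forms.
by rewrite -(limg_ker_dim (linfun (apolar_map (d := t) P))) capfv addKn.
Qed.

(** If all forms of degree [t.+1 <= l] annihilated [P], then by [Ann_mulX] so would all forms of
    degree [t], and finally the constant 1. *)
Lemma codim_Ann_gt0 t : (t <= l)%N -> (0 < rk t)%N.
Proof.
have rk0 k : rk k = 0%N -> forall Q : dhomog 2 F k, val Q \in Ann (val P).
  rewrite codim_Ann => /eqP; rewrite dimv_eq0 => /eqP e Q.
  have := memv_img (linfun (apolar_map (d := k) P)) (memvf Q).
  by rewrite e memv0 lfunE inE => /eqP /(congr1 val) /= ->.
elim: t => [|t ih] tl; rewrite lt0n; apply/eqP => /rk0 all.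
  have := all (DHomog (dhomog1 _ _)).
  rewrite inE /= -mpolyX0 apolarX mderivm0m => /eqP e.
  by move/eqP: P_neq0; apply; apply: val_inj.
have := ih (ltnW tl); rewrite codim_Ann lt0n dimv_eq0 => /negP; apply.
rewrite -subv0; apply/subvP => _ /memv_imgP[Q _ ->]; rewrite memv0 -memv_ker.
rewrite (graded_piece_Ann Q); apply: Ann_mulX => // i.
exact: all (mulh (linform i) Q).
Qed.

Lemma crank_eq r : apolar_scheme (val P) r ->
  (forall r', apolar_scheme (val P) r' -> (r <= r')%N) -> crank (val P) = r.
Proof.
move=> hr rmin; rewrite /crank; case: xgetP => [k _ [hk kmin]|]; last first.
  by move=> /(_ r) []; split.
by apply/eqP; rewrite eqn_leq kmin // rmin.
Qed.

Lemma dim_apolar_coker :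
  (0 < crank (val P) <= l./2.+1)%N /\
  forall d, (d <= l)%N ->
    \dim {: apolar_coker d P} =
      ((l - d).+1 - minn d.+1 (minn (crank (val P)) (l - d).+1))%N.
Proof.
have [||||t|r [rl hlt hr hE]] := @concave_profile rk l.
- move=> t tl; apply: (graded_piece_concave graded_piece_Ann) => [i f|f].
    exact: Ann_ideal.
  by apply: Ann_mulX; lia.
- exact: codim_Ann_gt0.
- exact: codim_Ann_gt0.
- by move=> t; rewrite /rk codim_binary_forms leq_subr.
- by rewrite codim_Ann -[leqRHS]dim_binary_forms dimvS ?subvf.
suff -> : crank (val P) = r.
  split=> // d /hE <-.
  by rewrite /apolar_coker /coker codim_binary_forms codim_Ann.
apply: crank_eq => [|r' [I [idI _ satI lenI IAnn]]].
  (* Since [rk r <= r], the annihilator contains a nonzero form of degree [r]; it generates an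
     apolar ideal of length [r]. *)
  have : (0 < \dim (W r))%N.
    by move: hr; rewrite /rk codim_binary_forms leq_subLR -add1n leq_add2r.
  rewrite lt0n dimv_eq0 -vpick0 => g_neq0; set g := vpick _ in g_neq0.
  have gAnn : val g \in Ann (val P) by rewrite -graded_piece_Ann memv_pick.
  exists (principal g); split.
  - by apply: principal_idealr => //; case/andP: rl.
  - exact: principal_homogeneous.
  - exact: principal_saturated.
  - exact: principal_length.
  by move=> _ /principalP[f ->]; rewrite mulrC; apply: Ann_ideal.
(* Minimality: length [r'] yields a nonzero form of degree [r'] in the annihilator, whereas
   [rk r' = r'.+1] for [r' < r] leaves none. *)
have [q q_neq0 /IAnn] := saturated_form_of_length idI satI lenI.
rewrite -graded_piece_Ann => qW; rewrite leqNgt; apply/negP => /hlt.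
rewrite /rk codim_binary_forms => e.
have /eqP : \dim (W r') = 0%N.
  by have := subKn (dim_leq_binary_forms (W r')); rewrite e subnn.
by rewrite dimv_eq0 => /eqP W0; move: qW; rewrite W0 memv0 (negbTE q_neq0).
Qed.

End Catalecticant.

End Apolar.

End BinaryForms.

(** * Comparison of the level sets *)

Theorem corollary3p10 (R : realType) (l d s : nat) (hd : d <= l) :
  (d <= l./2 ->
     [/\ (l - 2 * d < s <= l - d ->
            coker_level R[i] l d s = crank_level R[i] l (l - d + 1 - s)),
         (s = l - 2 * d ->
            coker_level R[i] l d s =
            \bigcup_(r in [set r | d + 1 <= r <= l./2 + 1])
              crank_level R[i] l r) &
         (s < l - 2 * d \/ l - d < s -> coker_level R[i] l d s = set0)]) /\
  (l./2 <= d ->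
     [/\ (0 < s <= l - d ->
            coker_level R[i] l d s = crank_level R[i] l (l - d + 1 - s)),
         (s = 0 ->
            coker_level R[i] l d s =
            \bigcup_(r in [set r | l - d + 1 <= r <= l./2 + 1])
              crank_level R[i] l r) &
         (l - d < s -> coker_level R[i] l d s = set0)]).
Proof.
have prof (P : dhomog 2 R[i] l) (nz : P != 0%R) :=
  dim_apolar_coker (Num.Theory.pchar_num _) nz.
(* The cokernel dimension depends on [P] only through its cactus rank [c], so an equality of level
   sets reduces to arithmetic over the possible values of [c]. *)
have levelE (A : set nat) :
    (forall c, 0 < c <= l./2.+1 ->
       (l - d).+1 - minn d.+1 (minn c (l - d).+1) = s <-> A c) ->
    coker_level R[i] l d s = \bigcup_(r in A) crank_level R[i] l r.
  move=> hA; apply/seteqP; split=> [p [P [nz [-> e]]]|p [r Ar [P [nz [-> e]]]]].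
    have [cP /(_ d hd) dimE] := prof P nz.
    exists (crank (val P)); last by exists P, nz.
    by apply/hA => //; rewrite -dimE.
  exists P, nz; split=> //; have [cP /(_ d hd) ->] := prof P nz.
  by apply/hA => //; rewrite e.
(* A single level is a union over a singleton and the empty set a union over no index, so [levelE]
   covers all six cases. *)
split=> hdl; split=> hs; rewrite -?(bigcup_set1 (crank_level R[i] l))
    -?(bigcup_set0 (crank_level R[i] l)); apply: levelE => c hc /=; split; lia.
Qed.
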